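(* Every tree-like $\mathrm{Res}(\oplus)$ refutation of $\mathrm{Ordering}_n$ has size at least $2^{n-2}$, and every $\mathrm{Res}(\oplus)$ refutation of $\mathrm{Ordering}_n$ has space at least $n-2$.
   Context: $\mathrm{Ordering}_n$ is the CNF in the variables $(x_{ij})_{i\neq j\in[n]}$ consisting of: $\neg x_{ij}\lor\neg x_{ji}$ for $i\neq j$; $x_{ij}\lor x_{ji}$ for $i\ne j$; $\neg x_{ij}\lor\neg x_{jk}\lor x_{ik}$ for distinct $i,j,k$; $\bigvee_{j\in[n]\setminus\{i\}} x_{ji}$ for each $i\in[n]$. It is viewed as a linear CNF by writing $x$ as $(x=1)$ and $\neg x$ as $(x=0)$. Linear clauses are disjunctions of equations $f=\alpha$ with $f$ a linear form over $\mathbb{F}_2$, $\alpha\in\{0,1\}$. $\mathrm{Res}(\oplus)$ has the rules: from $A\lor(f=0)$ and $B\lor(f=1)$ derive $A\lor B$; from $C$ derive any linear clause $D$ semantically implied by $C$. A refutation derives the empty clause from the clauses of the formula; it is tree-like if it can be arranged as a binary tree (root: empty clause, leaves: formula clauses, internal nodes: results of rule applications to their children), and its size is its number of clauses. Space: a refutation is a sequence of configurations (sets of linear clauses) $S_1=\emptyset,\dots,S_t\ni$ empty clause, each obtained from the previous by adding a formula clause, deleting a clause, or adding a clause deduced from the current clauses by the rules; its space is $\max_i|S_i|$. *)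

(* Defs.v *)
From mathcomp Require Import all_boot all_order all_algebra.

Set Implicit Arguments.
Unset Strict Implicit.
Unset Printing Implicit Defensive.

Import GRing.Theory.

(* The pair (f, alpha) stands for the equation f = alpha, where the linear form
   f over F_2 is given by its vector of coefficients. *)
Definition linear_eq (V : finType) := ({ffun V -> 'F_2} * 'F_2)%type.

Definition linear_clause (V : finType) := {set linear_eq V}.

(* The CNF consisting of the clauses C with F C; it is automatically finite,
   since V is. *)
Definition linear_cnf (V : finType) := linear_clause V -> Prop.

Definition sat_eq (V : finType) (a : {ffun V -> 'F_2}) (e : linear_eq V) : bool :=
  (\sum_v e.1 v * a v == e.2)%R.

Definition sat_clause (V : finType) (a : {ffun V -> 'F_2})
    (C : linear_clause V) : bool :=
  [exists e in C, sat_eq a e].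

Definition implied (V : finType) (C D : linear_clause V) : Prop :=
  forall a : {ffun V -> 'F_2}, sat_clause a C -> sat_clause a D.

(* A and B may themselves contain the equations resolved upon. *)
Inductive resolvent (V : finType) :
    linear_clause V -> linear_clause V -> linear_clause V -> Prop :=
| Resolvent (f : {ffun V -> 'F_2}) (A B : linear_clause V) :
    resolvent ((f, 0%R) |: A) ((f, 1%R) |: B) (A :|: B).

Inductive treelike (V : finType) (F : linear_cnf V) : linear_clause V -> Type :=
| Leaf (C : linear_clause V) : F C -> treelike F C
| Resolve (C1 C2 D : linear_clause V) :
    resolvent C1 C2 D -> treelike F C1 -> treelike F C2 -> treelike F D
| Weaken (C D : linear_clause V) :
    implied C D -> treelike F C -> treelike F D.

Definition treelike_refutation (V : finType) (F : linear_cnf V) : Type :=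
  treelike F set0.

Fixpoint treelike_size (V : finType) (F : linear_cnf V) (C : linear_clause V)
    (t : treelike F C) : nat :=
  match t with
  | Leaf _ _ => 1
  | Resolve _ _ _ _ t1 t2 => (treelike_size t1 + treelike_size t2).+1
  | Weaken _ _ _ t1 => (treelike_size t1).+1
  end.

Definition configuration (V : finType) := {set linear_clause V}.

Inductive config_step (V : finType) (F : linear_cnf V) :
    configuration V -> configuration V -> Prop :=
| Download (S : configuration V) (C : linear_clause V) :
    F C -> config_step F S (C |: S)
| Delete (S : configuration V) (C : linear_clause V) :
    C \in S -> config_step F S (S :\ C)
| InferRes (S : configuration V) (C1 C2 D : linear_clause V) :
    C1 \in S -> C2 \in S -> resolvent C1 C2 D -> config_step F S (D |: S)
| InferWeak (S : configuration V) (C D : linear_clause V) :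
    C \in S -> implied C D -> config_step F S (D |: S).

(* The last conjunct forces the sequence Ss to be nonempty. *)
Definition config_refutation (V : finType) (F : linear_cnf V)
    (Ss : seq (configuration V)) : Prop :=
  [/\ head set0 Ss = set0,
      forall t, t.+1 < size Ss -> config_step F (nth set0 Ss t) (nth set0 Ss t.+1)
    & (set0 : linear_clause V) \in last set0 Ss].

Definition config_space (V : finType) (Ss : seq (configuration V)) : nat :=
  \max_(S <- Ss) #|S|.

Definition lit (V : finType) (v : V) (b : bool) : linear_eq V :=
  ([ffun w => (w == v)%:R%R], b%:R%R).

Definition ord_var (n : nat) := {p : 'I_n * 'I_n | p.1 != p.2}.

Definition xvar (n : nat) (i j : 'I_n) (ij : i != j) : ord_var n :=
  exist (fun p : 'I_n * 'I_n => p.1 != p.2) (i, j) ij.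

Inductive Ordering (n : nat) : linear_cnf (ord_var n) :=
| Antisymmetry (i j : 'I_n) (ij : i != j) (ji : j != i) :
    Ordering [set lit (xvar ij) false; lit (xvar ji) false]
| Totality (i j : 'I_n) (ij : i != j) (ji : j != i) :
    Ordering [set lit (xvar ij) true; lit (xvar ji) true]
| Transitivity (i j k : 'I_n) (ij : i != j) (jk : j != k) (ik : i != k) :
    Ordering [set lit (xvar ij) false; lit (xvar jk) false; lit (xvar ik) true]
| NoMinimum (i : 'I_n) :
    Ordering [set lit v true | v : ord_var n & (val v).2 == i].

(* Main.v *)
Require Import Defs.
From mathcomp Require Import all_boot all_order all_algebra.

(** If a total order is changed by moving a set S of elements in front of all the
    others and reversing the order inside S, then, for s < t in the original
    order, the comparison of s and t is flipped exactly when t is in S.  So the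
    new assignment is an affine function of the indicator vector of S, and fewer
    than n - 1 equations satisfied by a total order cannot force a given i to be
    its minimum: they allow some nonempty S avoiding i.  A total order can only
    falsify the axioms "i is not the minimum", and by the above these are
    falsified on all total orders satisfying a system only if it has at least
    n - 1 equations.  In a tree, each equation that is not already forced costs a
    branching; in a configuration, one equation per clause suffices to keep all
    its clauses satisfied. *)

Set Implicit Arguments.
Unset Strict Implicit.
Unset Printing Implicit Defensive.

Import GRing.Theory.
Local Open Scope ring_scope.

Section LinearEquations.
Variable V : finType.
Implicit Types (a b : {ffun V -> 'F_2}) (C D : linear_clause V).

Lemma sat_eq_lit a v (c : bool) : sat_eq a (lit v c) = (a v == c%:R).
Proof.
rewrite /sat_eq /lit /= (bigD1 v) //= ffunE eqxx mul1r big1 ?addr0 // => w.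
by move=> /negPf neq_wv; rewrite ffunE neq_wv mul0r.
Qed.

Lemma sat_eq1 a f : sat_eq a (f, 1) = ~~ sat_eq a (f, 0).
Proof. by rewrite /sat_eq /=; case: (\sum_v _) => [[|[|m]] ltm]. Qed.

Lemma sat_clauseU a C D : sat_clause a (C :|: D) = sat_clause a C || sat_clause a D.
Proof.
apply/existsP/orP => [[e]|[]/existsP[e /andP[eC ae]]].
- rewrite inE => /andP[/orP[] eC ae]; [left | right];
    by apply/existsP; exists e; rewrite eC.
- by exists e; rewrite inE eC.
- by exists e; rewrite inE eC orbT.
Qed.

Lemma sat_clause1 a e : sat_clause a [set e] = sat_eq a e.
Proof.
apply/existsP/idP => [[e'] | ae]; first by rewrite inE => /andP[/eqP->].
by exists e; rewrite inE eqxx.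
Qed.

Lemma sat_clause0 a : sat_clause a set0 = false.
Proof. by apply/existsP => -[e]; rewrite inE. Qed.

Lemma resolvent_sound a C1 C2 D :
  resolvent C1 C2 D -> sat_clause a C1 -> sat_clause a C2 -> sat_clause a D.
Proof.
case=> f A B; rewrite !sat_clauseU !sat_clause1 sat_eq1.
by case: sat_eq; case: (sat_clause a A); case: (sat_clause a B).
Qed.

End LinearEquations.

Lemma exists_kernel_row (F : fieldType) (m k : nat) (A : 'M[F]_(m, k)) :
  (k < m)%N -> exists2 y : 'rV[F]_m, y != 0 & y *m A = 0.
Proof.
move=> ltkm; have kerA : kermx A != 0.
  rewrite -mxrank_eq0 mxrank_ker subn_eq0 -ltnNge.
  exact: leq_ltn_trans (rank_leq_col A) ltkm.
exists (nz_row (kermx A)); first by rewrite nz_row_eq0.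
exact/sub_kermxP/nz_row_sub.
Qed.

Section TotalOrders.
Variable n : nat.
Implicit Types (lt : rel 'I_n) (E : seq (linear_eq (ord_var n))).

Definition strict_total lt : Prop :=
  [/\ irreflexive lt, transitive lt & forall i j, i != j -> lt i j || lt j i].

Definition order_assignment lt : {ffun ord_var n -> 'F_2} :=
  [ffun v => (lt (val v).1 (val v).2)%:R].

Definition order_model E lt : Prop :=
  strict_total lt /\ all (sat_eq (order_assignment lt)) E.

Definition no_minimum (i : 'I_n) : linear_clause (ord_var n) :=
  [set lit v true | v : ord_var n & (val v).2 == i].

Lemma strict_total_ltn : strict_total (fun i j : 'I_n => (i < j)%N).
Proof.
split=> [i | j i k | i j]; [exact: ltnn | exact: ltn_trans |].
by rewrite -val_eqE neq_ltn.
Qed.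

Lemma sat_order_lit lt i j (ij : i != j) (c : bool) :
  sat_eq (order_assignment lt) (lit (xvar ij) c) = (lt i j == c).
Proof. by rewrite sat_eq_lit ffunE /=; case: (lt i j); case: c. Qed.

Lemma sat_no_minimum lt i j : irreflexive lt -> lt j i ->
  sat_clause (order_assignment lt) (no_minimum i).
Proof.
move=> irr ltji; have ji : j != i by apply: contraTneq ltji => ->; rewrite irr.
apply/existsP; exists (lit (xvar ji) true).
by rewrite sat_order_lit ltji eqxx andbT; apply/imsetP; exists (xvar ji); rewrite ?inE /=.
Qed.

Lemma Ordering_sat_or_no_minimum lt C : strict_total lt -> Ordering C ->
  sat_clause (order_assignment lt) C \/ exists i, C = no_minimum i.
Proof.
move=> [irr tr tot]; case=> [i j ij ji|i j ij ji|i j k ij jk ik|i]; last by right; exists i.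
- left; rewrite sat_clauseU !sat_clause1 !sat_order_lit !eqbF_neg -negb_and.
  by apply/negP => /andP[/tr/[apply]]; rewrite irr.
- by left; rewrite sat_clauseU !sat_clause1 !sat_order_lit !eqb_id tot.
- left; rewrite !sat_clauseU !sat_clause1 !sat_order_lit !eqbF_neg eqb_id.
  by rewrite -negb_and; case: andP => //= -[/tr/[apply]].
Qed.

(** Keeping the order inside the support of [y] would flip a pair [s < t] when [y t && ~~ y s],
    which is quadratic in [y]; reversing it leaves just [y t]. *)
Definition move_front lt (y : 'I_n -> bool) : rel 'I_n :=
  fun s t => if y s (+) y t then y s else if y s then lt t s else lt s t.

Lemma strict_total_move_front lt y :
  strict_total lt -> strict_total (move_front lt y).
Proof.
move=> [irr tr tot]; rewrite /move_front; split=> [i | j i k | i j ij].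
- by rewrite addbb irr if_same.
- case: (y i); case: (y j); case: (y k) => //=; last exact: tr.
  by move=> ji kj; apply: tr kj ji.
- case: (y i); case: (y j) => //=; last exact: tot.
  by rewrite orbC tot.
Qed.

(** Adding 1 in ['F_2] is the flip; the argument of [y] is the [lt]-larger element of the pair, in
    whichever order [v] lists it. *)
Lemma move_front_assignment lt y v : strict_total lt ->
  order_assignment (move_front lt y) v =
  order_assignment lt v + (y (if lt (val v).1 (val v).2 then (val v).2 else (val v).1))%:R.
Proof.
case=> irr tr tot; rewrite !ffunE /move_front.
case: v => -[i j] /= ij; have := tot _ _ ij.
case ltij: (lt i j); case ltji: (lt j i) => //= _; last 2 first.
- by case: (y i); case: (y j); apply/eqP.
- by case: (y i); case: (y j); apply/eqP.
- by have := tr _ _ _ ltij ltji; rewrite irr.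
Qed.

(** The set to move has [n] indicator bits under [(size E).+1] homogeneous linear conditions, one
    per equation and one keeping [i] out, so a nonempty choice remains; each [j] in it ends up
    before [i]. *)
Lemma order_model_above lt E i : order_model E lt -> ((size E).+1 < n)%N ->
  exists2 lt', order_model E lt' & exists j, lt' j i.
Proof.
move=> [totlt satE] ltEn.
pose top (v : ord_var n) := if lt (val v).1 (val v).2 then (val v).2 else (val v).1.
(* Column 0 encodes y i = 0; the others say that moving the support of y to the
   front preserves the left-hand sides of the equations in E. *)
pose A : 'M['F_2]_(n, (size E).+1) := \matrix_(j, c)
  if unlift ord0 c is Some k
  then \sum_(v | top v == j) (tnth (in_tuple E) k).1 v else (j == i)%:R.
have [y y_neq0 yA] := exists_kernel_row A ltEn.
pose z j := y 0 j != 0.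
have zE j : (z j)%:R = y 0 j.
  by rewrite /z; case: (y 0 j) => [[|[|m]] ltm] //=; apply/eqP.
have yi : z i = false.
  have /rowP/(_ ord0) := yA; rewrite !mxE (bigD1 i) //= mxE unlift_none eqxx mulr1.
  rewrite big1 ?addr0 => [|j /negPf ji]; first by rewrite /z => ->; rewrite eqxx.
  by rewrite mxE unlift_none ji mulr0.
have totlt' := strict_total_move_front z totlt.
exists (move_front lt z); last first.
  have /rV0Pn[j yj] := y_neq0; exists j.
  by rewrite /move_front yi /z yj.
split=> //; apply/allP => e eE; rewrite /sat_eq.
have /tnthP[k ek] : e \in in_tuple E by [].
(* This is the change of the left-hand side of [e], grouped by the larger element of each pair. *)
have yk : \sum_v e.1 v * y 0 (top v) = 0.
  have /rowP/(_ (lift ord0 k)) := yA; rewrite !mxE => yAk.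
  rewrite -[RHS]yAk (partition_big top xpredT) //=; apply: eq_bigr => j _.
  rewrite mxE liftK -ek mulr_sumr; apply: eq_bigr => v /eqP->.
  by rewrite mulrC.
have /eqP <- := allP satE _ eE; apply/eqP.
under eq_bigr do rewrite move_front_assignment // zE mulrDr.
by rewrite big_split /= yk addr0.
Qed.

(** Going up from the root, [E] gains an equation only where orders satisfying [E] take both values
    of the resolved form, and there both subtrees count. *)
Lemma treelike_size_bound C (t : treelike (@Ordering n) C) E :
  (exists lt, order_model E lt) ->
  (forall lt, order_model E lt -> ~~ sat_clause (order_assignment lt) C) ->
  (2 ^ (n - 1 - size E) <= treelike_size t)%N.
Proof.
elim: t E => {C} [C axC | C1 C2 D res t1 IH1 t2 IH2 | C D CD t1 IH] E [lt ltE] falsC /=.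
(* From [size E = n - 1] on, the truncated exponent is 0 and one leaf suffices; below that, some
   order model of [E] satisfies the axiom. *)
- have [ltsz | ] := ltnP (size E).+1 n; last by rewrite -subnDA add1n -subn_eq0 => /eqP->.
  have [satC | [i Ci]] := Ordering_sat_or_no_minimum ltE.1 axC.
    by have := falsC _ ltE; rewrite satC.
  have [lt' lt'E [j ltji]] := order_model_above i ltE ltsz.
  have [irr _ _] := lt'E.1.
  by have := falsC _ lt'E; rewrite Ci (sat_no_minimum irr ltji).
- move: (treelike_size t1) (treelike_size t2) IH1 IH2 => s1 s2.
  case: res falsC => f A B falsC IH1 IH2.
  have falsA lt' : order_model E lt' -> sat_clause (order_assignment lt') A = false.
    by move=> /falsC; rewrite sat_clauseU negb_or => /andP[/negPf].
  have falsB lt' : order_model E lt' -> sat_clause (order_assignment lt') B = false.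
    by move=> /falsC; rewrite sat_clauseU negb_or => /andP[_ /negPf].
  (* The goal is a boolean, so excluded middle is available. If no order model of [E] has [f = 0],
     the first premise is already false under [E] and its subtree alone meets the bound. *)
  apply: (@classic_EM (exists lt, order_model ((f, 0) :: E) lt)) => -[ex0 | nex0]; last first.
    apply: leq_trans (IH1 E _ _) _; [by exists lt | | by rewrite ltnW // ltnS leq_addr].
    move=> lt' lt'E; rewrite sat_clauseU sat_clause1 falsA // orbF.
    by apply/negP => sat0; case: nex0; exists lt'; case: lt'E; split=> //=; apply/andP.
  apply: (@classic_EM (exists lt, order_model ((f, 1) :: E) lt)) => -[ex1 | nex1]; last first.
    apply: leq_trans (IH2 E _ _) _; [by exists lt | | by rewrite ltnW // ltnS leq_addl].
    move=> lt' lt'E; rewrite sat_clauseU sat_clause1 falsB // orbF.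
    by apply/negP => sat1; case: nex1; exists lt'; case: lt'E; split=> //=; apply/andP.
  (* The values are crossed: [f = 1] makes [(f, 0) |: A] false, and [f = 0] makes [(f, 1) |: B]
     false. *)
  have le1 : (2 ^ (n - 1 - (size E).+1) <= s1)%N.
    apply: (IH1 ((f, 1) :: E)) => // lt' [totlt' /= /andP[]].
    rewrite sat_eq1 => /negPf nsat0 satE.
    by rewrite sat_clauseU sat_clause1 nsat0 falsA.
  have le2 : (2 ^ (n - 1 - (size E).+1) <= s2)%N.
    apply: (IH2 ((f, 0) :: E)) => // lt' [totlt' /= /andP[sat0 satE]].
    by rewrite sat_clauseU sat_clause1 sat_eq1 sat0 falsB.
  apply: leq_trans (leqW (leq_add le1 le2)).
  rewrite (subnS _ (size E)); case: (n - 1 - size E)%N => //= m.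
  by rewrite addnn -mul2n -expnS.
- apply: leqW; apply: IH; first by exists lt.
  by move=> lt' /falsC; apply/contra/CD.
Qed.

Definition order_satisfiable (S : configuration (ord_var n)) : Prop :=
  exists2 lt, strict_total lt & forall C, C \in S -> sat_clause (order_assignment lt) C.

(** Deletion and inference keep the same order; only downloading a [no_minimum] clause may need
    another one, found by preserving one true equation per clause of [S]. *)
Lemma config_step_order_satisfiable (S S' : configuration (ord_var n)) : (#|S|.+1 < n)%N ->
  config_step (@Ordering n) S S' -> order_satisfiable S -> order_satisfiable S'.
Proof.
move=> ltSn step [lt totlt satS]; case: step ltSn satS => {S S'}
  [S C axC|S C _|S C1 C2 D C1S C2S res|S C D CS CD] ltSn satS.
- have [satC | [i Ci]] := Ordering_sat_or_no_minimum totlt axC.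
    by exists lt => // D /setU1P[-> | /satS].
  (* The default is never reached for [D \in S], since such a clause has an equation true at
     [lt]. *)
  pose sel (D : linear_clause (ord_var n)) :=
    odflt ([ffun=> 0], 0) [pick e in D | sat_eq (order_assignment lt) e].
  have selP D : D \in S -> sel D \in D /\ sat_eq (order_assignment lt) (sel D).
    move=> /satS/existsP[e eD]; rewrite /sel.
    by case: pickP => [e' /andP[] | /(_ e)]; rewrite ?eD.
  have lt_model : order_model [seq sel D | D <- enum S] lt.
    split=> //; apply/allP => e /mapP[D]; rewrite mem_enum => DS ->.
    by have [] := selP D DS.
  have [|lt' [totlt' /allP satE] [j ltji]] := order_model_above i lt_model.
    by rewrite size_map -cardE.
  exists lt' => // D /setU1P[-> | DS].
    by have [irr _ _] := totlt'; rewrite Ci (sat_no_minimum irr ltji).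
  apply/existsP; exists (sel D); have [-> _] := selP D DS.
  by rewrite satE // map_f // mem_enum.
- by exists lt => // D /setD1P[_ /satS].
- exists lt => // C /setU1P[-> | /satS //].
  exact: resolvent_sound res (satS _ C1S) (satS _ C2S).
- exists lt => // C' /setU1P[-> | /satS //].
  exact/CD/satS.
Qed.

(** With all configurations below [n - 1] clauses, satisfiability by an order would persist up to
    the last one, which contains the empty clause. *)
Lemma config_space_bound (Ss : seq (configuration (ord_var n))) :
  config_refutation (@Ordering n) Ss -> (n - 1 <= config_space Ss)%N.
Proof.
case=> head0 steps last0; rewrite leqNgt; apply/negP => small.
have sat t : (t < size Ss)%N -> order_satisfiable (nth set0 Ss t).
  elim: t => [_ | t IH ltt].
    rewrite nth0 head0; exists (fun i j => (i < j)%N); first exact: strict_total_ltn.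
    by move=> C; rewrite inE.
  apply: config_step_order_satisfiable (steps t ltt) (IH (ltnW ltt)).
  move: small; rewrite ltn_subRL add1n; apply: leq_ltn_trans.
  by rewrite ltnS /config_space (big_rem _ (mem_nth set0 (ltnW ltt))) leq_maxl.
have Ss_gt0 : (0 < size Ss)%N by case: (Ss) last0; rewrite //= inE.
have [|lt _ /(_ set0)] := sat (size Ss).-1; first by rewrite prednK.
by rewrite nth_last => /(_ last0); rewrite sat_clause0.
Qed.

End TotalOrders.

Theorem theorem3p6 (n : nat) :
  (forall t : treelike_refutation (@Ordering n),
     2 ^ (n - 2) <= treelike_size t)%N /\
  (forall Ss : seq (configuration (ord_var n)),
     config_refutation (@Ordering n) Ss -> n - 2 <= config_space Ss)%N.
Proof.
(* Both bounds are obtained with [n - 1] and weakened to [n - 2]; the tree argument starts from no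
   equations. *)
split=> [t | Ss /config_space_bound]; last by apply: leq_trans; rewrite leq_sub2l.
have /(_ [::]) bound := treelike_size_bound t.
apply: leq_trans (bound _ _); first by rewrite subn0 leq_pexp2l // leq_sub2l.
  by exists (fun i j => (i < j)%N); split=> //; apply: strict_total_ltn.
by move=> lt _; rewrite sat_clause0.
Qed.
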